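(* For each integer $n\ge 1$ and $m=n+1$ there exists a uniquely optimal graph in $\mathcal{G}_{n,m}$, namely the balanced $\theta$-graph with $m$ edges.
   Context: Graphs are finite connected multigraphs (multiple edges and loops allowed), considered up to isomorphism. $\mathcal{G}_{n,m}$ is the set of connected graphs with $n$ vertices and $m$ edges. For $p\in(0,1)$, $R(G,p)$ is the probability that $G$ remains connected (on all its vertices) when each edge is independently retained with probability $p$ and deleted otherwise. $G\in\mathcal{G}_{n,m}$ is uniquely optimal if $R(G,p)>R(H,p)$ for all $p\in(0,1)$ and all other graphs $H\in\mathcal{G}_{n,m}$. The 3-dipole is the graph with two vertices joined by three parallel edges. A $\theta$-graph is a weak subdivision of the 3-dipole: assign to the three edges nonnegative integer lengths $\ell_1,\ell_2,\ell_3$, at most one of which is $0$; contract the edge of length $0$ (if any) and replace each edge of length $\ell\ge1$ by a path with $\ell$ edges. (If one length is $0$, the result is two cycles sharing one vertex.) It has $\ell_1+\ell_2+\ell_3$ edges, and is balanced if the lengths $\ell_1,\ell_2,\ell_3$ pairwise differ by at most one. *)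

(* Defs.v *)
From HB Require Import structures.
From mathcomp Require Import all_boot all_order all_algebra.
From mathcomp Require Import reals.

Set Implicit Arguments.
Unset Strict Implicit.
Unset Printing Implicit Defensive.

Import Order.TTheory GRing.Theory Num.Theory.
Local Open Scope ring_scope.

(* Finite multigraphs, with loops and parallel edges. The order of the two
   ends of an edge carries no meaning: both [adj] and [iso] ignore it. *)
Record mgraph := MGraph {
  vertex : finType;
  edge : finType;
  ends : edge -> vertex * vertex
}.

Definition adj (G : mgraph) (S : {set edge G}) : rel (vertex G) :=
  fun u v => [exists e in S, (ends e == (u, v)) || (ends e == (v, u))].

(* The spanning subgraph with edge set S, on all the vertices of G. *)
Definition spanning_connected (G : mgraph) (S : {set edge G}) : bool :=
  [forall u, forall v, connect (adj S) u v].

Definition connected (G : mgraph) : bool := spanning_connected [set: edge G].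

Definition iso (G H : mgraph) : Prop :=
  exists (f : vertex G -> vertex H) (g : edge G -> edge H),
    [/\ bijective f, bijective g &
        forall e, ends (g e) = (f (ends e).1, f (ends e).2) \/
                  ends (g e) = (f (ends e).2, f (ends e).1)].

Definition in_class (n m : nat) (G : mgraph) : Prop :=
  [/\ #|vertex G| = n, #|edge G| = m & connected G].

(* S ranges over the possible sets of retained edges. *)
Definition reliability (R : realType) (G : mgraph) (p : R) : R :=
  \sum_(S : {set edge G} | spanning_connected S)
    \prod_(e : edge G) (if e \in S then p else 1 - p).

(* Graphs are considered up to isomorphism, so "other" means "not isomorphic". *)
Definition uniquely_optimal (R : realType) (n m : nat) (G : mgraph) : Prop :=
  in_class n m G /\
  forall H, in_class n m H -> ~ iso H G ->
    forall p : R, 0 < p < 1 -> reliability H p < reliability G p.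

Lemma adj_connect_sym (G : mgraph) (S : {set edge G}) : connect_sym (adj S).
Proof.
apply: sym_connect_sym => u v; apply: eq_existsb => e.
by rewrite [X in _ && X]orbC.
Qed.

(* Contraction of the edges of F: every connected component of the spanning
   subgraph with edge set F becomes one vertex, represented by the canonical
   element of that component. *)
Definition contract_vertex (G : mgraph) (F : {set edge G}) : finType :=
  {v : vertex G | fingraph.roots (adj F) v}.

Definition contract_proj (G : mgraph) (F : {set edge G}) (v : vertex G) :
    contract_vertex F :=
  exist _ (fingraph.root (adj F) v) (roots_root (@adj_connect_sym G F) v).

Definition contract (G : mgraph) (F : {set edge G}) : mgraph :=
  @MGraph (contract_vertex F) {e : edge G | e \notin F}
    (fun e => (contract_proj F (ends (val e)).1,
               contract_proj F (ends (val e)).2)).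

(* Replacing each edge e by a path with l e edges, for l e >= 1, which has
   (l e).-1 inner vertices. An edge with l e = 0 would be deleted, not
   contracted. *)
Definition subdivide_vertex (G : mgraph) (l : edge G -> nat) : finType :=
  (vertex G + {e : edge G & 'I_(l e).-1})%type.

(* The k-th vertex of the path replacing e, for 0 <= k <= l e; [insub] fails
   exactly when k = l e. *)
Definition path_vertex (G : mgraph) (l : edge G -> nat) (e : edge G) (k : nat) :
    subdivide_vertex l :=
  match k with
  | 0 => inl (ends e).1
  | j.+1 => if (insub j : option 'I_(l e).-1) is Some i
            then inr (existT (fun e' => 'I_(l e').-1) e i)
            else inl (ends e).2
  end.

Definition subdivide (G : mgraph) (l : edge G -> nat) : mgraph :=
  @MGraph (subdivide_vertex l) {e : edge G & 'I_(l e)}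
    (fun x => (path_vertex l (tag x) (tagged x),
               path_vertex l (tag x) (tagged x).+1)).

Definition weak_subdivision (G : mgraph) (l : edge G -> nat) : mgraph :=
  @subdivide (contract [set e | l e == 0%N]) (fun e => l (val e)).

Definition dipole3 : mgraph :=
  @MGraph bool 'I_3 (fun _ => (false, true)).

Definition theta_lengths (l : 'I_3 -> nat) : Prop :=
  forall i j, l i = 0%N -> l j = 0%N -> i = j.

Definition balanced_lengths (l : 'I_3 -> nat) : Prop :=
  forall i j, (l i <= (l j).+1)%N.

Definition balanced_theta (G : mgraph) : Prop :=
  exists l : 'I_3 -> nat,
    [/\ theta_lengths l, balanced_lengths l &
        iso G (@weak_subdivision dipole3 l)].

(* Main.v *)
Require Import Defs.
From HB Require Import structures.
From mathcomp Require Import all_boot all_order all_algebra.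
From mathcomp Require Import reals.
From mathcomp Require Import perm zify ring.
From mathcomp Require boolp.

Set Implicit Arguments.
Unset Strict Implicit.
Unset Printing Implicit Defensive.

Import Order.TTheory GRing.Theory Num.Theory.
Local Open Scope ring_scope.

(** A connected graph with n vertices and n+1 edges has a cycle space of dimension
    2 over F_2, so every edge carries a label in the dual plane F_2^2, and the
    edges with nonzero label fall into at most three colour classes, one for each
    nonzero vector. The label of an edge is zero exactly when the edge is a bridge,
    and the removal of a set K of edges leaves the graph connected exactly when the
    labels of K are linearly independent: no bridge, no repeated colour, and not
    all three colours (spanning_connectedE). Hence, with l_1, l_2, l_3 the class
    sizes and q = 1 - p,

      R(p) = p^(n+1) + (l_1 + l_2 + l_3) p^n q
               + (l_1 l_2 + l_1 l_3 + l_2 l_3) p^(n-1) q^2     (reliabilityE).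

    Here l_1 + l_2 + l_3 is at most n+1, with equality when there is no bridge, and
    the sum of products is largest exactly when the sizes are moreover balanced,
    because
    6 (l_1 l_2 + l_1 l_3 + l_2 l_3) is 2 (l_1 + l_2 + l_3)^2 minus the sum of the
    squared differences (pair_products_balanced). A graph that does not reach both
    maxima is strictly worse for every p in (0,1).

    It remains to see that a bridgeless graph is the theta-graph on its class sizes
    (cycle_colouring_iso). The colouring is a flow: at each vertex the degrees in
    the three colours have the same parity. All degrees are at least 2 and the sum
    of the excesses over 2 is 2, so there are vertices a and b with
    deg v = 2 + [v = a] + [v = b]. A maximal trail of one colour starting from a
    must stop at b by parity, and by connectivity the three trails obtained in this
    way use all edges (trail_decomposition); so every colour class is a trail from
    a to b. Conversely a theta-graph has its three paths as colour classes
    (theta_cycle_colouring). *)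

(** * Arithmetic of F_2 and sums over three indices *)

Lemma F2_addxx (x : 'F_2) : x + x = 0.
Proof. exact: (addrr_pchar2 (pchar_Fp _)). Qed.

Lemma F2_addr_eq0 (x y : 'F_2) : (x + y == 0) = (x == y).
Proof. by rewrite -(inj_eq (addIr y)) -addrA F2_addxx addr0 add0r. Qed.

Lemma F2_neq0 (x : 'F_2) : x != 0 -> x = 1.
Proof. by case: x => [[|[|k]] hk] //= _; apply/val_inj. Qed.

Lemma F2_natr_eq0 (k : nat) : (k%:R == 0 :> 'F_2) = ~~ odd k.
Proof. by rewrite -(dvdn_pcharf (pchar_Fp _)) // dvdn2. Qed.

Lemma ord3P (i : 'I_3) : [\/ i = 0, i = 1 | i = 2%:R].
Proof.
by case: i => [[|[|[|k]]] hk] //; [apply: Or31|apply: Or32|apply: Or33];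
  apply: val_inj.
Qed.

Lemma sum_ord3 (V : nmodType) (F : 'I_3 -> V) : \sum_i F i = F 0 + F 1 + F 2%:R.
Proof.
rewrite !big_ord_recr big_ord0 /= add0r.
by congr (F _ + F _ + F _); apply: val_inj.
Qed.

(** * Colourings dual to the cycle space *)

(** The coboundary of a vertex function with values in F_2: the function on the edges
    whose support is the cut between the two level sets of y. *)
Definition coboundary (G : mgraph) (y : vertex G -> 'F_2) (e : edge G) : 'F_2 :=
  y (ends e).1 + y (ends e).2.

Definition colour_sum (G : mgraph) (c : edge G -> option 'I_3)
    (x : edge G -> 'F_2) (i : 'I_3) : 'F_2 :=
  \sum_(e | c e == Some i) x e.

(** A colouring of the edges that describes the cycle space of a graph of cyclomatic
    number 2. The value None stands for the zero vector of F_2^2 and the three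
    colours for the nonzero vectors, which add up to zero; so the sum of x e times
    the label of e vanishes exactly when the three colour sums agree. The condition
    says that these x are the coboundaries, that is, the orthogonal complement of
    the cycle space. It is invariant under permutation of the colours. *)
Definition cycle_colouring (G : mgraph) (c : edge G -> option 'I_3) : Prop :=
  forall x : edge G -> 'F_2,
    (exists y, x =1 coboundary y) <->
    (forall i j, colour_sum c x i = colour_sum c x j).

Definition colour_size (G : mgraph) (c : edge G -> option 'I_3)
    (i : 'I_3) : nat :=
  #|[set e | c e == Some i]|.

(** A function that takes equal values at the ends of each edge of S is constant on
    the components of S. *)
Lemma connect_adj_inv (G : mgraph) (S : {set edge G}) (T : Type)
    (y : vertex G -> T) u v :
    (forall e, e \in S -> y (ends e).1 = y (ends e).2) ->
  connect (adj S) u v -> y u = y v.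
Proof.
move=> yS /connectP[p + ->]; elim: p u => //= w p IHp u /andP[+ /IHp <-].
by case/existsP=> e /andP[/yS ye /orP[]/eqP ee]; rewrite ee in ye.
Qed.

Lemma adj_ends (G : mgraph) (S : {set edge G}) e :
  e \in S -> adj S (ends e).1 (ends e).2.
Proof.
by move=> eS; apply/existsP; exists e; rewrite eS; case: (ends e) => a b /=;
  rewrite eqxx.
Qed.

(** A spanning subgraph is disconnected exactly when a nonconstant function to F_2
    has a coboundary that vanishes on it. *)
Lemma spanning_connectedPn (G : mgraph) (S : {set edge G}) :
  reflect (exists y : vertex G -> 'F_2, exists u v,
             (forall e, e \in S -> coboundary y e = 0) /\ y u <> y v)
          (~~ spanning_connected S).
Proof.
apply: (iffP idP) => [|[y [u [v [yS yuv]]]]]; last first.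
  apply/negP => /forallP/(_ u)/forallP/(_ v) cuv; apply: yuv.
  by apply: connect_adj_inv cuv => e /yS/eqP; rewrite F2_addr_eq0 => /eqP.
case/forallPn=> u /forallPn[v nuv].
exists (fun w => (connect (adj S) u w)%:R), u, v; split.
  move=> e eS; apply/eqP; rewrite F2_addr_eq0.
  rewrite (same_connect_r (@adj_connect_sym G S) (connect1 (adj_ends eS))).
  by [].
by rewrite connect0 (negbTE nuv).
Qed.

Lemma connected_coboundary0 (G : mgraph) (y : vertex G -> 'F_2) u v :
  connected G -> (forall e, coboundary y e = 0) -> y u = y v.
Proof.
move=> Gc y0; apply/eqP; apply: contraT => /eqP yuv.
suff /negP[] : ~~ connected G by [].
by apply/spanning_connectedPn; exists y, u, v; split.
Qed.

(** Linear independence of the labels of K in F_2^2: no zero vector, no repeated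
    vector, and not all three nonzero vectors. *)
Definition independent (G : mgraph) (c : edge G -> option 'I_3)
    (K : {set edge G}) : bool :=
  [&& [forall e in K, c e != None], dinjectiveb c K &
      [exists i, Some i \notin [set c e | e in K]]].

Lemma colour_sum_indicator (G : mgraph) (c : edge G -> option 'I_3)
    (A : {set edge G}) i :
  colour_sum c (fun e => (e \in A)%:R) i =
    #|[set e in A | c e == Some i]|%:R.
Proof.
rewrite /colour_sum -sum1dep_card natr_sum [RHS]big_mkcondl /=.
by apply: eq_bigr => e _; case: (e \in A).
Qed.

(** The edges outside S can be deleted without disconnecting the graph exactly when
    their labels are independent: a dependency is a coboundary supported outside S,
    that is, a cut avoiding S. *)
Lemma spanning_connectedE (G : mgraph) (c : edge G -> option 'I_3)
    (S : {set edge G}) :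
  connected G -> cycle_colouring c ->
  spanning_connected S = independent c (~: S).
Proof.
move=> Gc cc; apply/idP/idP; last first.
  case/and3P=> /forallP cN /dinjectiveP cI /existsP[i0 ni0].
  apply: contraT => /spanning_connectedPn[y [u [v [yS]]]]; case.
  apply: connected_coboundary0 => // e.
  have /cc s_eq : exists y', coboundary y =1 coboundary y' by exists y.
  have s0 i : colour_sum c (coboundary y) i = 0.
    rewrite (s_eq i i0) /colour_sum big1 // => f /eqP cf.
    apply: yS; apply: contraR ni0 => fS; apply/imsetP; exists f => //.
    by rewrite inE.
  have [/yS //|eS] := boolP (e \in S).
  have := cN e; rewrite inE eS /=; case ce: (c e) => [i|] // _.
  rewrite -(s0 i) /colour_sum (bigD1 e) ?ce //= big1 ?addr0 //.
  move=> f /andP[/eqP cf fe].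
  apply: yS; apply: contraR fe => fS; apply/eqP/cI; rewrite ?inE //.
  by rewrite ce cf.
move=> Sc; apply: contraTT Sc => ncI; apply/negPn => Sc.
(* If A avoids S and meets all colours with the same parity, then its indicator is
   a coboundary that vanishes on S, hence the coboundary of a constant. *)
have key (A : {set edge G}) : A \subset ~: S ->
    (forall i j, odd #|[set e in A | c e == Some i]| =
                 odd #|[set e in A | c e == Some j]|) ->
    A = set0.
  move=> AS oA.
  have /cc[y xy] : forall i j, colour_sum c (fun e => (e \in A)%:R) i =
                               colour_sum c (fun e => (e \in A)%:R) j.
    move=> i j; rewrite !colour_sum_indicator; apply/eqP.
    by rewrite -F2_addr_eq0 -natrD F2_natr_eq0 oddD (oA i j) addbb.
  apply/setP => e; rewrite inE; apply/negP => eA.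
  have := xy e; rewrite eA /coboundary => /esym/eqP.
  suff -> : y (ends e).1 = y (ends e).2 by rewrite F2_addxx.
  apply: (@connect_adj_inv _ S).
    move=> f fS; apply/eqP; rewrite -F2_addr_eq0 -/(coboundary y f) -xy.
    by apply/eqP; case: (boolP (f \in A)) => // /(subsetP AS); rewrite inE fS.
  by move/forallP: Sc => /(_ (ends e).1)/forallP/(_ (ends e).2).
move/negP: ncI; apply; apply/and3P; split.
- apply/forallP => e; apply/implyP => eS; apply/eqP => ce.
  have /setP/(_ e) : [set e] = set0.
    apply: key; first by rewrite sub1set.
    suff E i : [set f in [set e] | c f == Some i] = set0 by move=> i j; rewrite !E.
    apply/setP => f; rewrite !inE; case: eqP => // ->; by rewrite ce.
  by rewrite !inE eqxx.
- apply/dinjectiveP => e f eS fS cef; apply/eqP; apply: contraT => ef.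
  have /setP/(_ e) : [set e; f] = set0.
    apply: key; first by rewrite subUset !sub1set eS.
    suff E i : odd #|[set g in [set e; f] | c g == Some i]| = false.
      by move=> i j; rewrite !E.
    case: (boolP (c e == Some i)) => cei.
      rewrite (_ : [set _ in _ | _] = [set e; f]) ?cards2 ?ef //.
      apply/setP => g; rewrite !inE; case: (g =P e) => [->|] //=.
      by case: (g =P f) => [->|] //=; rewrite -cef.
    rewrite (_ : [set _ in _ | _] = set0) ?cards0 //.
    apply/setP => g; rewrite !inE; case: (g =P e) => [->|] //=.
      by rewrite (negbTE cei).
    by case: (g =P f) => [->|] //=; rewrite -cef (negbTE cei).
  by rewrite !inE eqxx.
- apply: contraT; rewrite negb_exists => /forallP h.
  have {}h i : exists2 e, e \in ~: S & c e = Some i.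
    by have /negPn/imsetP[e eS ce] := h i; exists e.
  have [f0 f0S f0c] : exists2 f : 'I_3 -> edge G,
      (forall i, f i \in ~: S) & forall i, c (f i) = Some i.
    have h' i : exists e, (e \in ~: S) && (c e == Some i).
      by have [e ? /eqP ?] := h i; exists e; apply/andP.
    by exists (fun i => xchoose (h' i)) => i;
      case/andP: (xchooseP (h' i)) => // _ /eqP.
  have /setP/(_ (f0 ord0)) : [set f0 i | i : 'I_3] = set0.
    apply: key; first by apply/subsetP => _ /imsetP[i _ ->].
    suff E i : odd #|[set g in [set f0 i | i : 'I_3] | c g == Some i]| = true.
      by move=> i j; rewrite !E.
    rewrite (_ : [set _ in _ | _] = [set f0 i]) ?cards1 //.
    apply/setP => g; rewrite !inE; apply/andP/eqP => [[/imsetP[j _ ->]]|->].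
      by rewrite f0c => /eqP[->].
    by rewrite f0c eqxx imset_f.
  by rewrite !inE imset_f.
Qed.

(** * The reliability polynomial *)

Lemma independentE (G : mgraph) (c : edge G -> option 'I_3)
    (K : {set edge G}) :
  independent c K =
    [&& #|K| <= 2, [forall e in K, c e != None] & dinjectiveb c K]%N.
Proof.
rewrite /independent; apply/idP/idP.
  case/and3P=> cN /[dup] cI /dinjectiveP cI' /existsP[i ni]; rewrite cN cI !andbT.
  rewrite -(card_in_imset cI').
  rewrite (leq_trans (subset_leq_card _) (_ : #|Some @: [set~ i]| <= _)%N) //.
    apply/subsetP => _ /imsetP[e eK ->].
    have := forallP cN e; rewrite eK /=; case ce: (c e) => [j|] // _.
    rewrite imset_f // !inE; apply: contraNneq ni => <-.
    by apply/imsetP; exists e.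
  by rewrite card_imset ?cardsC1 ?card_ord //; apply: Some_inj.
case/and3P=> K2 -> ->; rewrite /=; apply: contraTT K2.
rewrite negb_exists => /forallP h.
rewrite -ltnNge (leq_trans _ (leq_imset_card c K)) //.
suff: (#|Some @: [set: 'I_3]| <= #|c @: K|)%N.
  by rewrite card_imset ?cardsT ?card_ord //; apply: Some_inj.
by apply/subset_leq_card/subsetP => _ /imsetP[i _ ->]; apply/negPn/h.
Qed.

Lemma card_coloured (G : mgraph) (c : edge G -> option 'I_3) :
  (#|[set e | c e != None]| = \sum_i colour_size c i)%N.
Proof.
rewrite -sum1dep_card (partition_big (fun e => odflt 0 (c e)) xpredT) //=.
apply: eq_bigr => i _; rewrite /colour_size -sum1dep_card; apply: eq_bigl => e.
by case: (c e).
Qed.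

Lemma card_independent1 (G : mgraph) (c : edge G -> option 'I_3) :
  (#|[set K | independent c K & #|K| == 1]| = \sum_i colour_size c i)%N.
Proof.
rewrite -card_coloured -(card_imset _ (@set1_inj (edge G))).
congr #|pred_of_set _|.
apply/setP => K; rewrite !inE; apply/andP/imsetP => [[+ /cards1P[e Ke]]|[e + ->]].
  rewrite Ke independentE => /and3P[_ /forallP/(_ e)].
  rewrite !inE eqxx /= => ce _.
  by exists e; rewrite ?inE.
rewrite inE independentE cards1 => ce; split=> //=; apply/andP; split.
  by apply/forallP => f; apply/implyP; rewrite inE => /eqP->.
by apply/dinjectiveP => f g; rewrite !inE => /eqP-> /eqP->.
Qed.

(** The second elementary symmetric function of the three lengths: the number of
    independent pairs of edges. *)
Definition pair_products (l : 'I_3 -> nat) : nat :=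
  (l 0%R * l 1%R + l 0%R * l 2%:R%R + l 1%R * l 2%:R%R)%N.

Lemma card_independent2 (G : mgraph) (c : edge G -> option 'I_3) :
  #|[set K | independent c K & #|K| == 2%N]| = pair_products (colour_size c).
Proof.
rewrite /pair_products; pose C i := [set e | c e == Some i].
pose X := setX (C 0) (C 1) :|: setX (C 0) (C 2%:R) :|: setX (C 1) (C 2%:R).
have XP (e f : edge G) :
    reflect (exists i j : 'I_3,
               [/\ c e = Some i, c f = Some j & (i < j)%N])
            ((e, f) \in X).
  rewrite !inE /=; apply: (iffP idP).
    by case/orP=> [/orP[]|] /andP[/eqP-> /eqP->]; do 2 eexists; split.
  by case=> i [j [-> ->]]; case: (ord3P i) => ->; case: (ord3P j) => ->.
have -> : [set K | independent c K & #|K| == 2%N] =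
          [set [set p.1; p.2] | p in X].
  apply/setP => K; rewrite !inE.
  apply/andP/imsetP => [[+ /cards2P[e [f [ef Ke]]]]|
                        [[e f] /XP[i [j [ce cf ij]]] ->]].
    rewrite Ke independentE => /and3P[_ /forallP cN /dinjectiveP cI].
    have := cN e; have := cN f; rewrite !inE !eqxx orbT /=.
    have := cI e f; rewrite !inE !eqxx orbT /= => /(_ isT isT).
    case ce: (c e) => [i|] //; case cf: (c f) => [j|] // ij _ _.
    case: (ltngtP i j) => [lij|lji|/val_inj eij].
    - by exists (e, f) => //; apply/XP; exists i, j.
    - by exists (f, e); [apply/XP; exists j, i | rewrite setUC].
    - by case/eqP: ef; apply: ij; rewrite eij.
  have ef : e != f.
    by apply: contraTneq ij => E; move: cf; rewrite -E ce => -[->]; rewrite ltnn.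
  rewrite independentE /= cards2 ef; split=> //=; apply/andP; split.
    apply/forallP => g; apply/implyP; rewrite !inE.
    by case/orP=> /eqP->; rewrite ?ce ?cf.
  have nij : i != j by rewrite -val_eqE neq_ltn ij.
  apply/dinjectiveP => g h; rewrite !inE.
  move=> /orP[]/eqP-> /orP[]/eqP->; rewrite ?ce ?cf //.
    by case=> /eqP; rewrite (negbTE nij).
  by case=> /eqP; rewrite eq_sym (negbTE nij).
rewrite card_in_imset; last first.
  move=> [e f] [e' f'] /XP[i [j [ce cf ij]]] /XP[i' [j' [ce' cf' ij']]] /= E.
  have := set21 e f; have := set22 e f; rewrite E !inE.
  case/orP=> /eqP E1; case/orP=> /eqP E2; subst => //.
  - by move: cf ij; rewrite ce => -[->]; rewrite ltnn.
  - move: ce ij cf; rewrite cf' => -[<-]; rewrite ce' => + [E3]; rewrite -E3.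
    by move/ltn_trans/(_ ij'); rewrite ltnn.
  - by move: cf ij; rewrite ce => -[->]; rewrite ltnn.
rewrite !cardsU !cardsX.
have -> : setX (C 0) (C 1) :&: setX (C 0) (C 2%:R) = set0.
  apply/setP => -[e f]; rewrite !inE /=.
  case: (c f) => [a|]; case: (c e) => [b|]; rewrite ?andbF //.
  by case: (ord3P a) => ->; rewrite ?andbF.
have -> : (setX (C 0) (C 1) :|: setX (C 0) (C 2%:R)) :&:
          setX (C 1) (C 2%:R) = set0.
  apply/setP => -[e f]; rewrite !inE /=.
  case: (c f) => [a|]; case: (c e) => [b|]; rewrite ?andbF //.
  by case: (ord3P b) => ->; rewrite ?andbF.
by rewrite !cards0 !subn0.
Qed.

(** Independent sets have at most two edges, so the reliability has three terms. The
    truncated subtractions are harmless: with fewer than one (two) edges the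
    corresponding coefficient is zero. *)
Lemma reliabilityE (R : realType) (G : mgraph) (c : edge G -> option 'I_3)
    (p : R) :
  connected G -> cycle_colouring c ->
  reliability G p =
    p ^+ #|edge G| +
    (\sum_i colour_size c i)%N%:R * (p ^+ (#|edge G| - 1) * (1 - p)) +
    (pair_products (colour_size c))%:R *
      (p ^+ (#|edge G| - 2) * (1 - p) ^+ 2).
Proof.
move=> Gc cc; rewrite /reliability (reindex_inj (inv_inj (@setCK _))) /=.
pose F k : R := p ^+ (#|edge G| - k) * (1 - p) ^+ k.
rewrite (eq_big (independent c) (fun K => F #|K|)); last 2 first.
- by move=> K; rewrite (spanning_connectedE _ Gc cc) setCK.
- move=> K _; rewrite (bigID [in K]) /= mulrC /F; congr (_ * _).
    rewrite (eq_bigr (fun=> p)); last by move=> e eK; rewrite inE eK.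
    by rewrite prodr_const -(cardC K) addKn; congr (_ ^+ _).
  rewrite (eq_bigr (fun=> 1 - p)); last by move=> e eK; rewrite inE eK.
  by rewrite prodr_const.
rewrite (partition_big (fun K : {set edge G} => inord #|K| : 'I_3) xpredT) //=.
rewrite sum_ord3.
have E (i : 'I_3) : \sum_(K | independent c K && (inord #|K| == i)) F #|K| =
         #|[set K | independent c K & #|K| == i]|%:R * F i.
  rewrite -sum1dep_card natr_sum mulr_suml; apply: eq_big => K.
    apply: andb_id2l; rewrite independentE => /and3P[K2 _ _].
    by rewrite -val_eqE /= inordK.
  case/andP; rewrite independentE mul1r => /and3P[K2 _ _] /eqP <-.
  by rewrite inordK.
rewrite !E [F _]/= /F /= subn0 expr0 mulr1 card_independent2.
rewrite card_independent1 expr1.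
have -> : [set K | independent c K & #|K| == 0%N] = [set set0].
  apply/setP => K; rewrite !inE cards_eq0 andbC; apply: andb_idr => /eqP->.
  rewrite independentE cards0 /=; apply/andP; split.
    by apply/forallP => e; rewrite inE.
  by apply/dinjectiveP => e f; rewrite inE.
by rewrite cards1 mul1r.
Qed.

(** * Existence of the colouring *)

(** The vertex-edge incidence matrix over F_2; a loop gives a zero column. *)
Definition incidence (G : mgraph) : 'M['F_2]_(#|vertex G|, #|edge G|) :=
  \matrix_(i, j) ((enum_val i == (ends (enum_val j)).1)%:R +
                  (enum_val i == (ends (enum_val j)).2)%:R).

Lemma mul_incidence (G : mgraph) (y : vertex G -> 'F_2) :
  (\row_i y (enum_val i)) *m incidence G = \row_j coboundary y (enum_val j).
Proof.
apply/rowP => j; rewrite !mxE.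
under eq_bigr do rewrite !mxE mulrDr !mulr_natr.
pose F w v : 'F_2 := y v *+ (v == w).
have E w : \sum_(i < #|vertex G|) F w (enum_val i) = y w.
  rewrite -(@big_enum_val _ _ _ _ xpredT (F w)) (bigD1 w) //= /F eqxx.
  by rewrite big1 ?addr0 // => v /negbTE->.
by rewrite big_split /= !E.
Qed.

(** The left kernel consists of the constant vectors, because the graph is connected. *)
Lemma mxrank_incidence (G : mgraph) :
  connected G -> \rank (incidence G) = #|vertex G|.-1.
Proof.
move=> Gc; have := mxrank_ker (incidence G).
case: (posnP #|vertex G|) => [n0|n_gt0].
  by move=> _; have := rank_leq_row (incidence G); lia.
have v0 : 'I_#|vertex G| := Ordinal n_gt0.
have -> : \rank (kermx (incidence G)) = 1%N.
  have -> : \rank (kermx (incidence G)) =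
            \rank (const_mx 1 : 'rV['F_2]_#|vertex G|).
    apply/eqmx_rank/andP; split.
      apply/rV_subP => u /sub_kermxP uD.
      apply/sub_rVP; exists (u 0 v0); apply/rowP => i; rewrite !mxE mulr1.
      pose y v := u 0 (enum_rank v).
      have -> k : u 0 k = y (enum_val k) by rewrite /y enum_valK.
      have -> : u 0 v0 = y (enum_val v0) by rewrite /y enum_valK.
      apply: connected_coboundary0 => // e.
      have := mul_incidence y; have -> : \row_k y (enum_val k) = u.
        by apply/rowP => k; rewrite !mxE /y enum_valK.
      by rewrite uD => /rowP/(_ (enum_rank e)); rewrite !mxE enum_rankK.
    apply/sub_kermxP; have := mul_incidence (fun _ : vertex G => 1).
    have -> : \row_(k < #|vertex G|) (1 : 'F_2) = const_mx 1.
      by apply/rowP => k; rewrite !mxE.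
    by move=> ->; apply/rowP => k; rewrite !mxE /coboundary F2_addxx.
  apply/eqP; rewrite eqn_leq rank_leq_row lt0n mxrank_eq0.
  by apply/eqP => /rowP/(_ v0)/eqP; rewrite !mxE oner_eq0.
by have := rank_leq_row (incidence G); lia.
Qed.

(** The cokernel of the incidence matrix has rank (n+1) - (n-1) = 2, and a column
    basis of it gives each edge a label in F_2^2. *)
Lemma cycle_colouring_exists (G : mgraph) :
  (0 < #|vertex G|)%N -> #|edge G| = #|vertex G|.+1 -> connected G ->
  exists c : edge G -> option 'I_3, cycle_colouring c.
Proof.
move=> n_gt0 mn Gc.
(* The coboundaries are cut out by two linear equations. *)
have [A HA] : exists A : 'M['F_2]_(#|edge G|, 2), forall x : 'rV_#|edge G|,
    (x <= incidence G)%MS = (x *m A == 0).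
  pose B := cokermx (incidence G).
  have [A HA] : exists A : 'M['F_2]_(#|edge G|, \rank B),
      forall x : 'rV_#|edge G|, (x <= incidence G)%MS = (x *m A == 0).
    exists (col_base B) => x; rewrite submxE -/B -[in LHS](mulmx_base B) mulmxA.
    apply/eqP/eqP => [|->]; last by rewrite mul0mx.
    by move/eqP; rewrite (mulmx_free_eq0 _ (row_base_free B)) => /eqP.
  move: A HA; have -> : \rank B = 2%N.
    by rewrite mxrank_coker mxrank_incidence // mn; lia.
  by move=> A HA; exists A.
(* The two coordinates of row e of A decide the colour of e. *)
pose al e := A (enum_rank e) 0; pose be e := A (enum_rank e) 1.
pose c e : option 'I_3 :=
  if al e == 0 then (if be e == 0 then None else Some 1)
  else (if be e == 0 then Some 0 else Some 2%:R).
exists c => x.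
pose rx : 'rV['F_2]_#|edge G| := \row_j x (enum_val j).
have -> : (exists y, x =1 coboundary y) <-> (rx <= incidence G)%MS.
  split=> [[y xy]|/submxP[u uD]].
    apply/submxP; exists (\row_i y (enum_val i)); rewrite mul_incidence.
    by apply/rowP => j; rewrite !mxE xy.
  exists (fun v => u 0 (enum_rank v)) => e.
  have := mul_incidence (fun v => u 0 (enum_rank v)).
  have -> : \row_k u 0 (enum_rank (enum_val k)) = u.
    by apply/rowP => k; rewrite !mxE enum_valK.
  by rewrite -uD => /rowP/(_ (enum_rank e)); rewrite !mxE enum_rankK.
have rxA k : (rx *m A) 0 k = \sum_e x e * A (enum_rank e) k.
  rewrite mxE [RHS](@big_enum_val _ _ _ _ xpredT).
  by apply: eq_bigr => i _; rewrite mxE enum_valK.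
have s0 : (rx *m A) 0 0 = colour_sum c x 0 + colour_sum c x 2%:R.
  rewrite rxA /colour_sum [X in _ = X + _]big_mkcond [X in _ = _ + X]big_mkcond.
  rewrite -big_split; apply: eq_bigr => e _ /=; rewrite /c /al /be.
  case: (eqVneq (A _ 0) 0) => [->|/F2_neq0->].
    by case: (A _ 1 == 0); rewrite mulr0 addr0.
  by case: (A _ 1 == 0); rewrite mulr1 ?addr0 ?add0r.
have s1 : (rx *m A) 0 1 = colour_sum c x 1 + colour_sum c x 2%:R.
  rewrite rxA /colour_sum [X in _ = X + _]big_mkcond [X in _ = _ + X]big_mkcond.
  rewrite -big_split; apply: eq_bigr => e _ /=; rewrite /c /al /be.
  case: (eqVneq (A _ 1) 0) => [->|/F2_neq0->].
    by case: (A _ 0 == 0); rewrite mulr0 addr0.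
  by case: (A _ 0 == 0); rewrite mulr1 ?addr0 ?add0r.
rewrite HA; split=> [/eqP r0|s_eq].
  have e0 : colour_sum c x 0 = colour_sum c x 2%:R.
    by apply/eqP; rewrite -F2_addr_eq0 -s0 r0 mxE.
  have e1 : colour_sum c x 1 = colour_sum c x 2%:R.
    by apply/eqP; rewrite -F2_addr_eq0 -s1 r0 mxE.
  have e2 i : colour_sum c x i = colour_sum c x 2%:R by case: (ord3P i) => ->.
  by move=> i j; rewrite !e2.
apply/eqP/rowP => k; rewrite [RHS]mxE.
have [->|->] : k = 0 \/ k = 1.
  by case: k => [[|[|k]] hk] //; [left|right]; apply: val_inj.
  by rewrite s0 (s_eq 0 2%:R) F2_addxx.
by rewrite s1 (s_eq 1 2%:R) F2_addxx.
Qed.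

(** * Balanced lengths maximize the sum of products *)

Lemma sq_diff_ge6 (a b c : int) : 2 <= a - b ->
  6 <= (a - b) ^+ 2 + (a - c) ^+ 2 + (b - c) ^+ 2.
Proof.
move=> h.
have h4 : 4 <= (a - b) ^+ 2 by nia.
suff : 2 <= (a - c) ^+ 2 + (b - c) ^+ 2 by lia.
case: (leP (a - c) 0) => ac; first by nia.
case: (leP (a - c) 1) => ac1; first by nia.
by nia.
Qed.

Lemma sq_diff_le2 (a b c : int) :
    a <= b + 1 -> b <= a + 1 -> a <= c + 1 -> c <= a + 1 -> b <= c + 1 ->
    c <= b + 1 ->
  (a - b) ^+ 2 + (a - c) ^+ 2 + (b - c) ^+ 2 <= 2.
Proof.
move=> h1 h2 h3 h4 h5 h6.
have [E1|[E1|E1]] : a = b \/ a = b + 1 \/ a = b - 1 by lia.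
all: have [E2|[E2|E2]] : c = b \/ c = b + 1 \/ c = b - 1 by lia.
all: nia.
Qed.

Lemma pair_products_sq (l : 'I_3 -> nat) :
  let a := (l 0)%:Z in let b := (l 1)%:Z in let c := (l 2%:R)%:Z in
  6 * (pair_products l)%:Z = 2 * ((\sum_i l i)%N%:Z) ^+ 2 -
    ((a - b) ^+ 2 + (a - c) ^+ 2 + (b - c) ^+ 2).
Proof.
move=> a b c; rewrite sum_ord3 /pair_products !PoszD !PoszM -/a -/b -/c; ring.
Qed.

Lemma pair_products_balanced (l l' : 'I_3 -> nat) :
  balanced_lengths l -> (\sum_i l' i <= \sum_i l i)%N ->
  (\sum_i l' i < \sum_i l i)%N \/ ~ balanced_lengths l' ->
  (pair_products l' <= pair_products l)%N /\
  ((\sum_i l' i < \sum_i l i)%N \/ (pair_products l' < pair_products l)%N).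
Proof.
move=> bl le_s ne.
have D : ((l 0)%:Z - (l 1)%:Z) ^+ 2 + ((l 0)%:Z - (l 2%:R)%:Z) ^+ 2 +
   ((l 1)%:Z - (l 2%:R)%:Z) ^+ 2 <= 2.
  move: (bl 0 1) (bl 1 0) (bl 0 2%:R) (bl 2%:R 0) (bl 1 2%:R) (bl 2%:R 1).
  by move=> *; apply: sq_diff_le2; lia.
have D' : (\sum_i l' i < \sum_i l i)%N \/
  6 <= ((l' 0)%:Z - (l' 1)%:Z) ^+ 2 + ((l' 0)%:Z - (l' 2%:R)%:Z) ^+ 2 +
   ((l' 1)%:Z - (l' 2%:R)%:Z) ^+ 2.
{ case: ne => [|nb]; [by left|right].
  have /existsP[i /existsP[j]] : [exists i, exists j, (l' j).+1 < l' i]%N.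
    apply: contraT; rewrite negb_exists => /forallP h; case: nb => i j.
    by have := h i; rewrite negb_exists => /forallP/(_ j); rewrite -leqNgt.
  have s6 := @sq_diff_ge6.
  case: (ord3P i) => ->; case: (ord3P j) => -> lij;
    try by rewrite ltnNge leqnSn in lij.
  all: [> have := s6 (l' 0)%:Z (l' 1)%:Z (l' 2%:R)%:Z
       |  have := s6 (l' 0)%:Z (l' 2%:R)%:Z (l' 1)%:Z
       |  have := s6 (l' 1)%:Z (l' 0)%:Z (l' 2%:R)%:Z
       |  have := s6 (l' 1)%:Z (l' 2%:R)%:Z (l' 0)%:Z
       |  have := s6 (l' 2%:R)%:Z (l' 0)%:Z (l' 1)%:Z
       |  have := s6 (l' 2%:R)%:Z (l' 1)%:Z (l' 0)%:Z ].
  all: by move=> s6'; nia. }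
have D'ge0 : 0 <= ((l' 0)%:Z - (l' 1)%:Z) ^+ 2 + ((l' 0)%:Z - (l' 2%:R)%:Z) ^+ 2 +
   ((l' 1)%:Z - (l' 2%:R)%:Z) ^+ 2 by rewrite !addr_ge0 ?sqr_ge0.
have := pair_products_sq l; have := pair_products_sq l' => /=.
move: D D' D'ge0 le_s {ne bl}.
move: (\sum_i l i)%N (\sum_i l' i)%N (_ + _ + _) (_ + _ + _).
move=> s s' d d' D D' D'0 le_s E' E.
case: D' => [lt_s|D'].
  by split; [nia|left].
have : (s' ^ 2 <= s ^ 2)%N by rewrite leq_sqr.
by split; [nia|right; nia].
Qed.

(** * The theta-graph *)

Lemma card_tagged_sum (I : finType) (T : I -> finType) :
  (#|{: {i : I & T i}}| = \sum_i #|T i|)%N.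
Proof. by rewrite card_tagged sumnE big_map big_enum. Qed.

Lemma path_vertex_end (G : mgraph) (l : edge G -> nat) (e : edge G) (k : nat) :
  (0 < k)%N -> (l e <= k)%N -> path_vertex l e k = inl (ends e).2.
Proof. by case: k => // k _ lk; rewrite /path_vertex insubF //; lia. Qed.

Lemma path_vertex_inner (G : mgraph) (l : edge G -> nat) (e : edge G)
    (i : 'I_(l e).-1) :
  path_vertex l e i.+1 = inr (existT (fun e' => 'I_(l e').-1) e i).
Proof. by rewrite /path_vertex valK. Qed.

Notation theta l := (@weak_subdivision dipole3 l).
(** The edges of the dipole to be contracted. *)
Notation zero_edges l := ([set e | l e == 0%N] : {set edge dipole3}).

(** The two vertices of the dipole are identified as soon as one edge is contracted. *)
Lemma contract_dipole3 (F : {set edge dipole3}) :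
  (contract_proj F false == contract_proj F true) = (F != set0).
Proof.
rewrite -val_eqE /= (root_connect (@adj_connect_sym dipole3 F)).
apply/idP/set0Pn => [cft|[e eF]]; last first.
  exact: connect1 (@adj_ends dipole3 F e eF).
have [F0|/set0Pn //] := eqVneq F set0.
suff : false = true by [].
apply: connect_adj_inv (id : vertex dipole3 -> bool) _ _ _ cft => e.
by rewrite F0 inE.
Qed.

Lemma contract_projK (G : mgraph) (F : {set edge G}) (w : contract_vertex F) :
  contract_proj F (val w) = w.
Proof. by apply: val_inj; case: w => w /= /eqP. Qed.

(** The k-th vertex of the path of the theta-graph that replaces the edge e. *)
Definition theta_path (l : 'I_3 -> nat) (e : edge (contract (zero_edges l)))
    (k : nat) : vertex (theta l) :=
  @path_vertex (contract (zero_edges l)) (fun e' => l (val e')) e k.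

Lemma theta_path_end (l : 'I_3 -> nat) (e : edge (contract (zero_edges l))) k :
  k = l (val e) -> theta_path e k = inl (contract_proj (zero_edges l) true).
Proof.
move=> kl; apply: path_vertex_end; rewrite kl //.
by have := valP e; rewrite inE lt0n.
Qed.

(** Universal property of the vertex set: three sequences with a common start and a
    common end glue to one function on the vertices. When some length is 0, the
    start and the end of its sequence coincide, which agrees with the contraction. *)
Lemma theta_vertex_map (l : 'I_3 -> nat) (T : Type) (P : 'I_3 -> nat -> T) a b :
    (forall i, P i 0%N = a) -> (forall i, P i (l i) = b) ->
  exists f : vertex (theta l) -> T,
    forall (e : edge (contract (zero_edges l))) k, (k <= l (val e))%N ->
      f (theta_path e k) = P (val e) k.
Proof.
move=> Pa Pb; pose F := zero_edges l.
exists (fun v => match v with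
  | inl w => if w == contract_proj F false then a else b
  | inr (existT e i) => P (val e) (nat_of_ord i).+1
  end) => e [|k] hk; first by rewrite /= eqxx Pa.
have [kl|ne] := eqVneq k.+1 (l (val e)).
  rewrite (theta_path_end kl) kl eq_sym contract_dipole3.
  case: ifP => [/set0Pn[e0]|_]; last by rewrite Pb.
  by rewrite inE Pb => /eqP l0; rewrite -(Pa e0) -(Pb e0) l0.
have hk' : (k < (l (val e)).-1)%N by move: hk ne; lia.
pose l' (e' : edge (contract (zero_edges l))) := l (val e').
by rewrite /theta_path (@path_vertex_inner _ l' e (Ordinal hk')).
Qed.

(** Every vertex lies on one of the three paths. *)
Lemma theta_vertexP (l : 'I_3 -> nat) (v : vertex (theta l)) :
  theta_lengths l ->
  exists (e : edge (contract (zero_edges l))) (k : nat),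
    (k <= l (val e))%N /\
    v = theta_path e k.
Proof.
move=> tl; case: v => [w|[e i]]; last first.
  exists e, i.+1; split; first exact: leq_trans (ltn_ord i) (leq_pred _).
  by rewrite /theta_path path_vertex_inner.
have [e _] : exists e : edge (contract (zero_edges l)), true.
  suff [e he] : exists e : edge dipole3, e \notin zero_edges l.
    by exists (exist _ e he).
  have [/eqP l0|l0] := boolP (l 0 == 0%N); last by exists 0; rewrite inE.
  by exists 1; rewrite inE; apply/eqP => l1; have := tl _ _ l0 l1.
rewrite -(contract_projK w); case: (val w).
  by exists e, (l (val e)); split=> //; rewrite (theta_path_end (erefl _)).
by exists e, 0%N.
Qed.

Lemma big_theta_edge (V : nmodType) (l : 'I_3 -> nat) (F : 'I_3 -> nat -> V) :
  \sum_(x : edge (theta l)) F (val (tag x)) (tagged x) =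
  \sum_i \sum_(k < l i) F i k.
Proof.
rewrite -(@sig_big_dep _ _ _ (edge (contract (zero_edges l)))
  (fun e => 'I_(l (val e))) xpredT (fun=> xpredT) (fun e k => F (val e) k)) /=.
rewrite [RHS](bigID (fun i : edge dipole3 => i \in zero_edges l)) /=.
rewrite [X in _ = X + _]big1 ?add0r; last first.
  by move=> i; rewrite inE => /eqP->; rewrite big_ord0.
by rewrite (big_sub [pred i : 'I_3 | i \notin zero_edges l]).
Qed.

Lemma card_theta_edge (l : 'I_3 -> nat) : #|edge (theta l)| = (\sum_i l i)%N.
Proof.
rewrite -sum1_card (big_theta_edge l (fun _ _ => 1%N)).
by apply: eq_bigr => i _; rewrite sum1_card card_ord.
Qed.

Lemma card_theta_vertex (l : 'I_3 -> nat) :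
  theta_lengths l -> (#|vertex (theta l)|.+1 = \sum_i l i)%N.
Proof.
move=> tl; pose F := zero_edges l; rewrite -card_theta_edge.
rewrite /= card_sum !card_tagged_sum /=.
have -> : #|contract_vertex F| = (F == set0).+1.
  rewrite -cardsT; have -> : [set: contract_vertex F] =
      [set contract_proj F false; contract_proj F true].
    apply/setP => w; rewrite !inE -{1 2}(contract_projK w).
    by case: (val w); rewrite eqxx ?orbT.
  by rewrite cards2 contract_dipole3 negbK.
rewrite -addSn.
have -> : ((F == set0).+2 = #|edge (contract F)|)%N.
  have cF : #|F| = (F != set0).
    have [->|/set0Pn[e eF]] := eqVneq; first by rewrite cards0.
    rewrite (_ : F = [set e]) ?cards1 //; apply/setP => f; rewrite inE.
    apply/idP/eqP => [|->//]; move: eF; rewrite !inE => /eqP e0 /eqP f0.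
    exact: tl.
  have := cardC [in F]; rewrite card_ord cF card_sig.
  have -> : #|[predC F]| = #|[pred x | x \notin F]| by apply: eq_card.
  by case: (F == set0) => /= E; apply/esym; [exact: E | case: E].
rewrite -sum1_card -big_split /=; apply: eq_bigr => e _.
by rewrite !card_ord add1n prednK //; have := valP e; rewrite inE lt0n.
Qed.

Lemma theta_edge_inj (l : 'I_3 -> nat) (x y : edge (theta l)) :
  val (tag x) = val (tag y) -> (tagged x : nat) = tagged y -> x = y.
Proof.
case: x y => [e i] [e' i'] /= /val_inj ee; case: e' / ee i' => i' ii.
by congr existT; apply: val_inj.
Qed.

Lemma theta_ends (l : 'I_3 -> nat) (x : edge (theta l)) :
  ends x = (theta_path (tag x) (tagged x), theta_path (tag x) (tagged x).+1).
Proof. by []. Qed.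

Lemma theta_connected (l : 'I_3 -> nat) : theta_lengths l -> connected (theta l).
Proof.
move=> tl; pose v0 : vertex (theta l) := inl (contract_proj (zero_edges l) false).
have cv0 v : connect (adj [set: edge (theta l)]) v0 v.
  have [e [k [+ ->]]] := theta_vertexP v tl.
  elim: k => [_|k IHk hk]; first exact: connect0.
  apply: connect_trans (IHk (ltnW hk)) (connect1 _).
  exact: (@adj_ends (theta l) setT (existT _ e (Ordinal hk)) (in_setT _)).
apply/forallP => u; apply/forallP => v.
by apply: connect_trans (cv0 v); rewrite (@adj_connect_sym (theta l)).
Qed.

(** The colouring of the theta-graph by its three paths. *)
Definition theta_colour (l : 'I_3 -> nat) (x : edge (theta l)) : option 'I_3 :=
  Some (val (tag x)).

Lemma theta_colour_size (l : 'I_3 -> nat) (i : 'I_3) :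
  colour_size (@theta_colour l) i = l i.
Proof.
rewrite /colour_size -sum1dep_card big_mkcond /=.
rewrite (big_theta_edge l (fun j _ => if Some j == Some i then 1%N else 0%N)).
rewrite (bigD1 i) //= eqxx [X in _ + X]big1 => [|j ji].
  by rewrite addr0 sum_nat_const card_ord muln1.
by rewrite (inj_eq Some_inj) (negbTE ji) big1.
Qed.

(** The sum of x over the first k edges of the i-th path. *)
Definition prefix_sum (V : nmodType) (l : 'I_3 -> nat) (x : edge (theta l) -> V)
    (i : 'I_3) (k : nat) : V :=
  \sum_(e : edge (theta l) | (val (tag e) == i) && (tagged e < k)%N) x e.

Lemma prefix_sumS (V : nmodType) (l : 'I_3 -> nat) (x : edge (theta l) -> V)
    (e : edge (theta l)) :
  prefix_sum x (val (tag e)) (tagged e).+1 =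
  prefix_sum x (val (tag e)) (tagged e) + x e.
Proof.
rewrite /prefix_sum (bigD1 e) /= ?eqxx ?ltnSn // addrC; congr (_ + _).
apply: eq_bigl => f; rewrite -andbA; apply: andb_id2l => /eqP fe.
rewrite ltnS ltn_neqAle andbC; congr (~~ _ && _).
by apply/eqP/eqP => [->//|]; apply: theta_edge_inj.
Qed.

Lemma prefix_sum_full (l : 'I_3 -> nat) (x : edge (theta l) -> 'F_2) i :
  prefix_sum x i (l i) = colour_sum (@theta_colour l) x i.
Proof.
apply: eq_bigl => e; rewrite /theta_colour (inj_eq Some_inj).
by apply: andb_idr => /eqP <-.
Qed.

(** The sum of a coboundary along a path telescopes to y a + y b. Conversely, if the
    three sums of x agree, then the prefix sums of x glue to a vertex function with
    coboundary x. *)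
Lemma theta_cycle_colouring (l : 'I_3 -> nat) :
  theta_lengths l -> cycle_colouring (@theta_colour l).
Proof.
move=> tl x; split=> [[y xy] i j|s_eq].
  pose v1 : vertex (theta l) := inl (contract_proj (zero_edges l) true).
  pose v0 : vertex (theta l) := inl (contract_proj (zero_edges l) false).
  suff s k : colour_sum (@theta_colour l) x k = y v0 + y v1 by rewrite !s.
  have [l0|l0] := eqVneq (l k) 0%N.
    rewrite -prefix_sum_full /prefix_sum big1.
      suff -> : v0 = v1 by rewrite F2_addxx.
      congr inl; apply/eqP; rewrite contract_dipole3; apply/set0Pn.
      by exists k; rewrite inE l0.
    by move=> e; rewrite l0 ltn0 andbF.
  have hk : k \notin zero_edges l by rewrite inE.
  pose e : edge (contract (zero_edges l)) := exist _ k hk.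
  have ps j' : (j' <= l (val e))%N ->
      prefix_sum x k j' = y v0 + y (theta_path e j').
    elim: j' => [_|j' IH hj].
      by rewrite F2_addxx /prefix_sum big1 // => ? /andP[].
    have := prefix_sumS x (existT _ e (Ordinal hj) : edge (theta l)).
    rewrite /= => ->; rewrite IH 1?ltnW // xy /coboundary.
    rewrite -addrA; congr (_ + _); rewrite addrA /=.
    rewrite -/(theta_path e j') -/(theta_path e j'.+1).
    by rewrite F2_addxx add0r.
  by rewrite -prefix_sum_full ps // (theta_path_end (erefl _)).
have P0 i : prefix_sum x i 0 = 0 by rewrite /prefix_sum big1 // => ? /andP[].
have P1 i : prefix_sum x i (l i) = colour_sum (@theta_colour l) x 0.
  by rewrite prefix_sum_full; apply: s_eq.
have [y yP] := theta_vertex_map P0 P1; exists y => e.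
rewrite /coboundary theta_ends.
rewrite !yP; [|exact: ltn_ord|exact: ltnW (ltn_ord _)].
by rewrite prefix_sumS addrA F2_addxx add0r.
Qed.

Lemma connected_incident (G : mgraph) (v : vertex G) :
  connected G -> (0 < #|edge G|)%N ->
  exists e, v = (ends e).1 \/ v = (ends e).2.
Proof.
move=> Gc /card_gt0P[e0 _].
move/forallP: Gc => /(_ v)/forallP/(_ (ends e0).1)/connectP[[|w p]] /=.
  by move=> _ <-; exists e0; left.
case/andP=> /existsP[e /andP[_ he]] _ _; exists e.
by case/orP: he => /eqP->; [left|right].
Qed.

Lemma surj_card_bij (T T' : finType) (f : T -> T') :
  (forall y, exists x, y = f x) -> (#|T| <= #|T'|)%N -> bijective f.
Proof.
move=> fs le_T; apply: inj_card_bij.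
  apply/injectiveP/dinjectiveP/imset_injP; rewrite eqn_leq leq_imset_card.
  apply: leq_trans le_T _; rewrite -cardsT subset_leq_card //.
  by apply/subsetP => y _; have [x ->] := fs y; apply: imset_f.
rewrite -[#|T'|]cardsT (leq_trans _ (leq_imset_card f T)) // subset_leq_card //.
by apply/subsetP => y _; have [x ->] := fs y; apply: imset_f.
Qed.

(** A connected graph whose edges are arranged in three trails from a to b is a
    theta-graph. The trails give a bijection on the edges and a map on the vertices;
    the latter is onto, since each vertex lies on some edge, and hence bijective by
    counting. *)
Lemma theta_iso (l : 'I_3 -> nat) (G : mgraph) (P : 'I_3 -> nat -> vertex G)
    (E : 'I_3 -> nat -> edge G) a b :
    theta_lengths l -> connected G ->
    #|edge G| = (\sum_i l i)%N -> #|vertex G|.+1 = #|edge G| ->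
    (forall i, P i 0%N = a) -> (forall i, P i (l i) = b) ->
    (forall i k, (k < l i)%N ->
       ends (E i k) = (P i k, P i k.+1) \/ ends (E i k) = (P i k.+1, P i k)) ->
    (forall i k i' k', (k < l i)%N -> (k' < l i')%N -> E i k = E i' k' ->
       i = i' /\ k = k') ->
  iso (theta l) G.
Proof.
move=> tl Gc mG nG Pa Pb endsE injE.
have [f fP] := theta_vertex_map Pa Pb.
pose g (x : edge (theta l)) := E (val (tag x)) (tagged x).
have fends (x : edge (theta l)) :
    f (ends x).1 = P (val (tag x)) (tagged x) /\
    f (ends x).2 = P (val (tag x)) (tagged x).+1.
  by rewrite theta_ends !fP //; exact: ltnW (ltn_ord _).
have gb : bijective g.
  apply: inj_card_bij; last by rewrite card_theta_edge mG.
  move=> x y /injE; case; [exact: ltn_ord|exact: ltn_ord|].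
  exact: theta_edge_inj.
exists f, g; split=> // [|x]; last first.
  by have [-> ->] := fends x; apply: endsE; apply: ltn_ord.
have [g' _ gK] := gb.
apply: surj_card_bij => [v|]; last first.
  by rewrite -ltnS card_theta_vertex // -mG nG.
have [|e ve] := connected_incident v Gc; first by rewrite -nG.
have := endsE (val (tag (g' e))) (tagged (g' e)) (ltn_ord _).
rewrite -/(g (g' e)) gK; have [<- <-] := fends (g' e) => ee.
by case: ee ve => -> /= [] ->;
  [exists (ends (g' e)).1|exists (ends (g' e)).2
  |exists (ends (g' e)).2|exists (ends (g' e)).1].
Qed.

(** * Transport along isomorphisms *)

Lemma iso_sym (G H : mgraph) : iso G H -> iso H G.
Proof.
case=> f [g [[f' fK f'K] [g' gK g'K] fg]]; exists f', g'.
split; [by exists f|by exists g|].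
move=> e; have := fg (g' e); rewrite g'K; case: (ends (g' e)) => u v /=.
by case=> ->; rewrite /= !fK; [left|right].
Qed.

Lemma iso_trans (G H K : mgraph) : iso G H -> iso H K -> iso G K.
Proof.
case=> f [g [fb gb fg]] [f' [g' [fb' gb' fg']]].
exists (f' \o f), (g' \o g); split; [exact: bij_comp|exact: bij_comp|] => e /=.
by case: (fg' (g e)) => ->; case: (fg e) => -> /=; [left|right|right|left].
Qed.

Lemma iso_connected (G H : mgraph) : iso G H -> connected G -> connected H.
Proof.
case=> f [g [[f' fK f'K] gb fg]] Gc; apply/forallP => u; apply/forallP => v.
rewrite -(f'K u) -(f'K v).
move/forallP: Gc => /(_ (f' u))/forallP/(_ (f' v))/connectP[p + ->].
elim: p (f' u) => [|w p IHp] z /=; first by rewrite connect0.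
case/andP=> /existsP[e /andP[_ ee]] /IHp; apply: connect_trans; apply: connect1.
apply/existsP; exists (g e); rewrite inE /=.
by case/orP: ee (fg e) => /eqP-> [] -> /=; rewrite eqxx ?orbT.
Qed.

Lemma iso_cycle_colouring (G H : mgraph) (c : edge G -> option 'I_3) :
  iso G H -> cycle_colouring c ->
  exists2 c' : edge H -> option 'I_3, cycle_colouring c' &
    colour_size c' =1 colour_size c.
Proof.
case=> f [g [[f' fK f'K] [g' gK g'K] fg]] cc; exists (c \o g'); last first.
  move=> i; rewrite /colour_size -(card_imset _ (can_inj g'K)).
  apply: eq_card => e; rewrite inE; apply/imsetP/idP => [[e']|ce].
    by rewrite inE => ? ->.
  by exists (g e); rewrite ?inE /= gK.
have cob (y : vertex H -> 'F_2) e : coboundary y (g e) = coboundary (y \o f) e.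
  by rewrite /coboundary; case: (fg e) => -> //=; rewrite addrC.
move=> x.
have s i : colour_sum (c \o g') x i = colour_sum c (x \o g) i.
  rewrite /colour_sum (reindex g) /=; last by exists g' => ? _; rewrite ?gK ?g'K.
  by apply: eq_bigl => e; rewrite gK.
split=> [[y xy] i j|s_eq].
  rewrite !s; apply: (proj1 (cc (x \o g))); exists (y \o f) => e /=.
  by rewrite xy cob.
have /cc[y xy] : forall i j, colour_sum c (x \o g) i = colour_sum c (x \o g) j.
  by move=> i j; rewrite -!s.
exists (y \o f') => e; rewrite -(g'K e) cob -[LHS]/((x \o g) (g' e)) xy.
by rewrite /coboundary /= !fK.
Qed.

(** * Decomposition of a bridgeless graph into three trails *)

(** The number of ends of e at v, which is 2 for a loop at v. *)
Definition incident (G : mgraph) (v : vertex G) (e : edge G) : nat :=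
  ((v == (ends e).1) + (v == (ends e).2))%N.

Definition degree (G : mgraph) (v : vertex G) : nat := (\sum_e incident v e)%N.

Definition colour_degree (G : mgraph) (c : edge G -> option 'I_3) (i : 'I_3)
    (v : vertex G) : nat :=
  (\sum_(e | c e == Some i) incident v e)%N.

Lemma sum_degree (G : mgraph) : (\sum_(v : vertex G) degree v = 2 * #|edge G|)%N.
Proof.
rewrite exchange_big /= (eq_bigr (fun=> 2%N)).
  by rewrite sum_nat_const mulnC.
have one w : (\sum_v (v == w) = 1)%N.
  by rewrite (bigD1 w) //= eqxx big1 // => v /negbTE->.
by move=> e _; rewrite big_split /= !one.
Qed.

Lemma sum_colour_degree (G : mgraph) (c : edge G -> option 'I_3)
    (v : vertex G) :
  (forall e, c e != None) ->
  degree v = (\sum_i colour_degree c i v)%N.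
Proof.
move=> cN; rewrite /degree (partition_big (fun e => odflt 0 (c e)) xpredT) //=.
apply: eq_bigr => i _; apply: eq_bigl => e.
by have := cN e; case: (c e).
Qed.

(** The coboundary of the indicator function of v is the parity of incidence with v,
    so the three colour degrees of v are congruent mod 2; their sum, the degree, has
    the same parity as each of them. *)
Lemma odd_colour_degree (G : mgraph) (c : edge G -> option 'I_3)
    (i : 'I_3) (v : vertex G) :
  cycle_colouring c -> (forall e, c e != None) ->
  odd (colour_degree c i v) = odd (degree v).
Proof.
move=> cc cN.
pose y (w : vertex G) : 'F_2 := (v == w)%:R.
have s j : colour_sum c (coboundary y) j = (colour_degree c j v)%:R.
  by rewrite natr_sum; apply: eq_bigr => e _; rewrite natrD.
have odd_eq j : odd (colour_degree c j v) = odd (colour_degree c i v).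
  have /cc/(_ j i) : exists y', coboundary y =1 coboundary y' by exists y.
  rewrite !s => /eqP; rewrite -F2_addr_eq0 -natrD F2_natr_eq0 oddD.
  by case: odd; case: odd.
rewrite (sum_colour_degree _ cN) sum_ord3 !oddD !odd_eq.
by case: odd.
Qed.

(** A vertex of degree 1 would have three odd colour degrees. *)
Lemma degree_ge2 (G : mgraph) (c : edge G -> option 'I_3)
    (v : vertex G) :
  connected G -> (0 < #|edge G|)%N -> cycle_colouring c ->
  (forall e, c e != None) -> (2 <= degree v)%N.
Proof.
move=> Gc mG cc cN.
have d0 : (0 < degree v)%N.
  have [e ve] := connected_incident v Gc mG.
  rewrite /degree (bigD1 e) //= /incident.
  by case: ve => <-; rewrite eqxx ?addn1 ?add1n.
have od i := odd_colour_degree i v cc cN.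
have := sum_colour_degree v cN; rewrite sum_ord3 -[(_ + _)%R]/(_ + _ + _)%N.
move: (od 0) (od 1) (od 2%:R) d0.
by case: (degree v) => [|[|d]] //; case: (colour_degree _ 0 _) => [|x] //;
  case: (colour_degree _ 1 _) => [|y] //; rewrite addnS.
Qed.

Lemma sum_nat_eq2 (T : finType) (g : T -> nat) :
  (\sum_v g v = 2)%N ->
  exists a b, forall v, g v = ((v == a) + (v == b))%N.
Proof.
have pick (h : T -> nat) k : (\sum_v h v = k.+1)%N ->
    exists a (h' : T -> nat),
      (forall v, h v = (v == a) + h' v)%N /\ (\sum_v h' v = k)%N.
  move=> hk; have [a ha] : exists a, (0 < h a)%N.
    apply/existsP; apply: contraT; rewrite negb_exists => /forallP h0.
    by rewrite big1 // in hk => v _; apply/eqP; rewrite -leqn0 leqNgt h0.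
  exists a, (fun v => h v - (v == a))%N.
  have E v : h v = ((v == a) + (h v - (v == a)))%N by case: eqP => [->|] //; lia.
  split=> //; move: hk; under eq_bigr do rewrite E.
  rewrite big_split /= (bigD1 a) //= eqxx big1 => [|v /negbTE-> //].
  by rewrite addn0 add1n => -[].
case/pick=> a [h [gh /pick[b [h' [hh' h'0]]]]]; exists a, b => v.
rewrite gh hh'; have -> : h' v = 0%N; last by rewrite addn0.
by apply/eqP; move/eqP: h'0; rewrite sum_nat_eq0 => /forallP/(_ v).
Qed.

(** A dart (e, r) is the edge e traversed from its first end to its second end, or
    backwards if r is true. *)
Definition dart_source (G : mgraph) (d : edge G * bool) : vertex G :=
  if d.2 then (ends d.1).2 else (ends d.1).1.

Definition dart_target (G : mgraph) (d : edge G * bool) : vertex G :=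
  if d.2 then (ends d.1).1 else (ends d.1).2.

Fixpoint walk (G : mgraph) (u : vertex G) (s : seq (edge G * bool))
    (v : vertex G) : bool :=
  if s is d :: s' then (u == dart_source d) && walk (dart_target d) s' v
  else u == v.

Lemma walk_rcons (G : mgraph) (u v w : vertex G) s d :
  walk u s v -> v = dart_source d -> w = dart_target d -> walk u (rcons s d) w.
Proof.
elim: s u => [|d' s IHs] u /=; first by move=> /eqP-> -> ->; rewrite !eqxx.
by case/andP=> -> /IHs; apply.
Qed.

(** The vertex reached from u after k steps along the walk s. *)
Definition walk_vertex (G : mgraph) (u : vertex G) (s : seq (edge G * bool))
    (k : nat) : vertex G :=
  last u [seq dart_target d | d <- take k s].

Lemma walk_vertexP (G : mgraph) (u v : vertex G) s (d0 : edge G * bool) :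
  walk u s v ->
  walk_vertex u s (size s) = v /\
  forall k, (k < size s)%N ->
    dart_source (nth d0 s k) = walk_vertex u s k /\
    dart_target (nth d0 s k) = walk_vertex u s k.+1.
Proof.
elim: s u => [|d s IHs] u /=; first by move/eqP.
case/andP=> /eqP ud /IHs[end_v IH]; split; first by rewrite -end_v.
case=> [_|k hk] /=; first by rewrite /walk_vertex /= take0.
by apply: IH.
Qed.

Lemma odd_walk_incident (G : mgraph) (u v w : vertex G) s :
  walk u s v -> odd (\sum_(d <- s) incident w d.1) = (w == u) (+) (w == v).
Proof.
elim: s u => [|d s IHs] u /=; first by move/eqP->; rewrite big_nil addbb.
case/andP=> /eqP-> /IHs IH; rewrite big_cons oddD IH.
have -> : odd (incident w d.1) = (w == dart_source d) (+) (w == dart_target d).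
  by rewrite /incident /dart_source /dart_target; case: d.2; case: eqP; case: eqP.
by rewrite -addbA; congr (_ (+) _); rewrite addbA addbb.
Qed.

(** A trail from u with edges in A that cannot be extended: all edges of A at its
    final vertex are used. *)
Lemma maximal_trail (G : mgraph) (A : {set edge G}) (u : vertex G) :
  exists s v, [/\ walk u s v, uniq [seq d.1 | d <- s],
    {subset [seq d.1 | d <- s] <= A} &
    forall e, e \in A -> (0 < incident v e)%N -> e \in [seq d.1 | d <- s]].
Proof.
suff ext k s v : walk u s v -> uniq [seq d.1 | d <- s] ->
    {subset [seq d.1 | d <- s] <= A} -> (#|edge G| <= size s + k)%N ->
    exists s v, [/\ walk u s v, uniq [seq d.1 | d <- s],
      {subset [seq d.1 | d <- s] <= A} &
      forall e, e \in A -> (0 < incident v e)%N -> e \in [seq d.1 | d <- s]].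
  by apply: (ext #|edge G| [::] u) => //=.
elim: k s v => [|k IHk] s v ws us sA hk.
  exists s, v; split=> // e _ _; apply: contraT => es.
  have : uniq (e :: [seq d.1 | d <- s]) by rewrite /= es.
  move/card_uniqP; have := max_card [in e :: [seq d.1 | d <- s]].
  move=> le_c E; move: le_c.
  by rewrite E /= size_map leqNgt ltnS -[size s]addn0 hk.
have [/existsP[e /and3P[eA ve es]]|] := boolP [exists e,
    [&& e \in A, (0 < incident v e)%N & e \notin [seq d.1 | d <- s]]].
  have [d de dv] : exists2 d : edge G * bool, d.1 = e & v = dart_source d.
    move: ve; rewrite /incident; case: eqP => [ve _|_]; first by exists (e, false).
    by case: eqP => // ve _; exists (e, true).
  apply: (IHk (rcons s d) (dart_target d)).
  - exact: walk_rcons ws dv _.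
  - by rewrite map_rcons rcons_uniq de es.
  - by move=> f; rewrite map_rcons mem_rcons inE de => /orP[/eqP->|/sA].
  - by rewrite size_rcons addSnnS.
rewrite negb_exists => /forallP h; exists s, v; split=> // e eA ve.
by have := h e; rewrite eA ve /= negbK.
Qed.

(** In a bridgeless graph each colour class is a trail between two vertices a and b
    that do not depend on the colour; a and b may coincide, and then a class may be
    empty. *)
Lemma trail_decomposition (G : mgraph) (c : edge G -> option 'I_3) :
  connected G -> #|edge G| = #|vertex G|.+1 -> cycle_colouring c ->
  (forall e, c e != None) ->
  exists a b (s : 'I_3 -> seq (edge G * bool)), forall i,
    [/\ walk a (s i) b, uniq [seq d.1 | d <- s i] &
        forall e, (e \in [seq d.1 | d <- s i]) = (c e == Some i)].
Proof.
move=> Gc mG cc cN.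
have m0 : (0 < #|edge G|)%N by rewrite mG.
(* a and b are the vertices of degree 3, or both the vertex of degree 4. *)
have [a [b dP]] : exists a b : vertex G, forall v,
    (degree v - 2 = (v == a) + (v == b))%N.
  apply: sum_nat_eq2; have := sum_degree G; rewrite mG.
  rewrite (eq_bigr (fun v => (degree v - 2) + 2)%N); last first.
    by move=> v _; rewrite subnK // (degree_ge2 v Gc m0 cc cN).
  rewrite big_split /=; have -> : (\sum_(v : vertex G) 2 = #|vertex G| * 2)%N.
    by rewrite sum_nat_const.
  by rewrite mul2n -muln2 mulSn => /eqP; rewrite eqn_add2r => /eqP.
have {}dP v : degree v = ((v == a) + (v == b) + 2)%N.
  by rewrite -dP subnK // (degree_ge2 v Gc m0 cc cN).
have /fin_all_exists[s sP] i := maximal_trail [set e | c e == Some i] a.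
(* The edge set of the i-th trail, and below its degree w i v at v. *)
pose W i := [set e in [seq d.1 | d <- s i]].
pose w i v := (\sum_(e in W i) incident v e)%N.
have sWc i e : e \in W i -> c e == Some i.
  by rewrite inE; have [v [_ _ + _]] := sP i; move=> h /h; rewrite inE.
have w_s i v : w i v = (\sum_(d <- s i) incident v d.1)%N.
  have [z [_ us _ _]] := sP i.
  rewrite -(big_map fst xpredT (incident v)) /= (big_uniq _ us) /=.
  by apply: eq_bigl => e; rewrite inE.
have deg_w i v : (colour_degree c i v =
    w i v + \sum_(e | (c e == Some i) && (e \notin W i)) incident v e)%N.
  rewrite /colour_degree (bigID [in W i]) /=; congr (_ + _)%N.
  by apply: eq_bigl => e; apply: andb_idl => /sWc.
have w_full i v :
    (forall e, c e == Some i -> (0 < incident v e)%N -> e \in W i) ->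
    w i v = colour_degree c i v.
  move=> h; rewrite deg_w big1 ?addn0 // => e /andP[ce eW].
  by apply/eqP; rewrite -leqn0 leqNgt; apply: contra eW; apply: h.
have odd_deg v : odd (degree v) = (v == a) (+) (v == b).
  by rewrite dP !oddD addbF; case: eqP; case: eqP.
(* The maximal trail of colour i ends at b, by parity. *)
have sb i : walk a (s i) b /\ w i b = colour_degree c i b.
  have [v [ws us sub mx]] := sP i.
  have wv : w i v = colour_degree c i v.
    by apply: w_full => e ce ve; rewrite inE; apply: mx; rewrite ?inE.
  suff <- : v = b by [].
  have := odd_walk_incident v ws.
  rewrite -w_s wv odd_colour_degree // odd_deg eqxx.
  by case: (v == a); case: eqP.
have odd_w i v : odd (w i v) = (v == a) (+) (v == b).
  by rewrite w_s (odd_walk_incident v (proj1 (sb i))).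
(* At b or at a vertex visited by the trails, the trails use up the degree: at b
   by maximality, at a they have odd degree in each of the three colours, and any
   other visited vertex has degree 2. *)
have w_deg v : (exists j e, e \in W j /\ (0 < incident v e)%N) \/ v = b ->
    (degree v <= \sum_i w i v)%N.
  case: (eqVneq v b) => [-> _|vb].
    rewrite (sum_colour_degree _ cN).
    by apply: leq_sum => i _; rewrite (proj2 (sb i)).
  case=> [[j [e [eW ve]]]|/eqP]; last by rewrite (negbTE vb).
  rewrite dP (negbTE vb); have [va|va] := eqVneq v a.
    have w1 i : (0 < w i v)%N.
      by apply: odd_gt0; rewrite odd_w va eqxx -va (negbTE vb).
    rewrite sum_ord3; move: (w1 0) (w1 1) (w1 2%:R).
    by case: (w 0 v) (w 1 v) (w 2%:R v) => [|x] [|y] [|z] // _ _ _; lia.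
  rewrite (bigD1 j) //=; suff : (2 <= w j v)%N by lia.
  have : (0 < w j v)%N by rewrite /w (bigD1 e) //=; lia.
  by have := odd_w j v; rewrite (negbTE va) (negbTE vb); case: (w j v) => [|[|]].
have Wall v : (exists j e, e \in W j /\ (0 < incident v e)%N) \/ v = b ->
    forall e, (0 < incident v e)%N -> exists i, e \in W i.
  move=> /w_deg; rewrite (sum_colour_degree _ cN) => le_dw e ve.
  have := cN e; case ce: (c e) => [i|] // _; exists i; apply: contraT => eW.
  move: le_dw; rewrite leqNgt (bigD1 i) //= [X in (_ < X)%N](bigD1 i) //=.
  rewrite -addSn leq_add //; last by apply: leq_sum => k _; rewrite deg_w leq_addr.
  by rewrite deg_w (bigD1 e) ?ce ?eqxx //=; lia.
pose X (v : vertex G) : bool :=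
  [forall e, (0 < incident v e)%N ==> [exists i, e \in W i]].
have XP v : (exists j e, e \in W j /\ (0 < incident v e)%N) \/ v = b -> X v.
  move=> /Wall h; apply/forallP => e; apply/implyP => /h[i eW].
  by apply/existsP; exists i.
(* The set X of vertices all of whose edges are used contains b and is closed
   under adjacency. *)
have Xv v : X v.
  have <- : X b = X v; last by apply: XP; right.
  have inc1 e : (0 < incident (ends e).1 e)%N by rewrite /incident eqxx.
  have inc2 e : (0 < incident (ends e).2 e)%N by rewrite /incident eqxx addn1.
  apply: (@connect_adj_inv G setT) => [e _|]; last first.
    by move/forallP: Gc => /(_ b)/forallP.
  apply/idP/idP => /forallP/(_ e); rewrite ?inc1 ?inc2 => /existsP[i eW].
    by apply: XP; left; exists i, e.
  by apply: XP; left; exists i, e.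
have Wc i e : (e \in W i) = (c e == Some i).
  apply/idP/idP; first exact: sWc.
  move/eqP=> ce; move/forallP: (Xv (ends e).1) => /(_ e).
  rewrite /incident eqxx => /existsP[j eW].
  by move: (sWc _ _ eW); rewrite ce => /eqP[->].
exists a, b, s => i; have [v [_ us _ _]] := sP i.
split=> //; first by have [] := sb i.
by move=> e; rewrite -Wc inE.
Qed.

(** The three classes can be assigned to the lengths in any order f. *)
Lemma cycle_colouring_iso (G : mgraph) (c : edge G -> option 'I_3)
    (l : 'I_3 -> nat) (f : 'I_3 -> 'I_3) :
  connected G -> #|edge G| = #|vertex G|.+1 -> cycle_colouring c ->
  (forall e, c e != None) -> injective f ->
  (forall i, l i = colour_size c (f i)) ->
  theta_lengths l -> iso (theta l) G.
Proof.
move=> Gc mG cc cN finj lE tl.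
have [a [b [s sP]]] := trail_decomposition Gc mG cc cN.
have /card_gt0P[e0 _] : (0 < #|edge G|)%N by rewrite mG.
have size_s i : size (s i) = colour_size c i.
  have [_ us mem_s] := sP i; rewrite -(size_map fst) -(card_uniqP us).
  by apply: eq_card => e; rewrite mem_s inE.
pose E i k := (nth (e0, false) (s (f i)) k).1.
apply: (@theta_iso l G (fun i k => walk_vertex a (s (f i)) k) E a b) => //.
- rewrite -cardsT (_ : [set: edge G] = [set e | c e != None]).
    by rewrite card_coloured (reindex_inj finj); apply: eq_bigr => i _.
  by apply/setP => e; rewrite !inE cN.
- by move=> i; rewrite /walk_vertex take0.
- move=> i; rewrite lE -size_s; have [ws _ _] := sP (f i).
  by have [] := walk_vertexP (e0, false) ws.
- move=> i k; rewrite lE -size_s => hk; have [ws _ _] := sP (f i).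
  have [_ /(_ k hk)[<- <-]] := walk_vertexP (e0, false) ws.
  rewrite /E /dart_source /dart_target; case: (nth _ _ _) => e [] /=.
    by right; case: (ends e).
  by left; case: (ends e).
- move=> i k i' k'; rewrite !lE -!size_s => hk hk' EE.
  have cE j k0 : (k0 < size (s (f j)))%N -> c (E j k0) = Some (f j).
    move=> h; have [_ _ mem_s] := sP (f j); apply/eqP; rewrite -mem_s.
    by apply/map_f/mem_nth.
  have ii : i = i'.
    by apply: finj; apply: Some_inj; rewrite -(cE _ _ hk) -(cE _ _ hk') EE.
  split=> //; rewrite -{i'}ii in hk' EE; have [_ us _] := sP (f i).
  apply/eqP; rewrite -(nth_uniq e0 _ _ us) ?size_map //.
  by rewrite !(nth_map (e0, false)) //; apply/eqP.
Qed.

(** * Optimality of the balanced theta-graph *)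

(** Balanced triples with the same sum agree up to order. *)
Lemma balanced_lengths_perm (l l' : 'I_3 -> nat) :
  balanced_lengths l -> balanced_lengths l' ->
  (\sum_i l i = \sum_i l' i)%N ->
  exists2 f : 'I_3 -> 'I_3, injective f & forall i, l i = l' (f i).
Proof.
move=> bl bl'; rewrite !sum_ord3.
move: (bl 0 1) (bl 1 0) (bl 0 2%:R) (bl 2%:R 0) (bl 1 2%:R) (bl 2%:R 1) => {bl}.
move: (bl' 0 1) (bl' 1 0) (bl' 0 2%:R) (bl' 2%:R 0)
  (bl' 1 2%:R) (bl' 2%:R 1) => {bl'}.
move=> b1 b2 b3 b4 b5 b6 d1 d2 d3 d4 d5 d6 ee.
(* Each of l and l' takes at most two consecutive values, the larger one equally
   often; so l and l' differ by at most one transposition. *)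
have [e|[e|[e|e]]] : (l 0 = l' 0 /\ l 1 = l' 1 /\ l 2%:R = l' 2%:R) \/
         (l 0 = l' 1 /\ l 1 = l' 0 /\ l 2%:R = l' 2%:R) \/
         (l 0 = l' 2%:R /\ l 1 = l' 1 /\ l 2%:R = l' 0) \/
         (l 0 = l' 0 /\ l 1 = l' 2%:R /\ l 2%:R = l' 1).
  move: ee b1 b2 b3 b4 b5 b6 d1 d2 d3 d4 d5 d6.
  move: (l 0) (l 1) (l 2%:R) (l' 0) (l' 1) (l' 2%:R) => x y z x' y' z'.
  by rewrite -!/(_ + _)%N; lia.
all: case: e => [e0 [e1 e2]].
- by exists id => [|i] //; case: (ord3P i) => ->.
- exists (tperm 0 1); first exact: perm_inj.
  by move=> i; case: (ord3P i) => ->; rewrite ?tpermL ?tpermR ?tpermD.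
- exists (tperm 0 2%:R); first exact: perm_inj.
  by move=> i; case: (ord3P i) => ->; rewrite ?tpermL ?tpermR ?tpermD.
- exists (tperm 1 2%:R); first exact: perm_inj.
  by move=> i; case: (ord3P i) => ->; rewrite ?tpermL ?tpermR ?tpermD.
Qed.

Lemma iso_in_class (G H : mgraph) n m :
  iso G H -> in_class n m G -> in_class n m H.
Proof.
move=> GH [nG mG Gc]; split; last exact: iso_connected GH Gc.
  by rewrite -nG; case: GH => f [g [/bij_eq_card-> _ _]].
by rewrite -mG; case: GH => f [g [_ /bij_eq_card-> _]].
Qed.

Lemma theta_in_class (l : 'I_3 -> nat) n :
  theta_lengths l -> (\sum_i l i = n.+1)%N -> in_class n n.+1 (theta l).
Proof.
move=> tl ln; split; [|by rewrite card_theta_edge|exact: theta_connected].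
by apply/eqP; rewrite -eqSS card_theta_vertex // ln.
Qed.

Lemma reliability_lt (R : realType) n (G H : mgraph) (c : edge G -> option 'I_3)
    (d : edge H -> option 'I_3) (p : R) :
  (0 < n)%N -> in_class n n.+1 G -> in_class n n.+1 H ->
  cycle_colouring c -> cycle_colouring d -> 0 < p < 1 ->
  let l := colour_size c in let k := colour_size d in
  (\sum_i k i <= \sum_i l i)%N -> (pair_products k <= pair_products l)%N ->
  (\sum_i k i < \sum_i l i)%N \/ (pair_products k < pair_products l)%N ->
  reliability H p < reliability G p.
Proof.
move=> n0 [nG mG Gc] [nH mH Hc] cc cd /andP[p0 p1] l k.
rewrite (reliabilityE _ Gc cc) (reliabilityE _ Hc cd) mG mH.
rewrite -/l -/k.
have q0 : 0 < 1 - p by rewrite subr_gt0.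
have X0 : 0 < p ^+ (n.+1 - 1) * (1 - p) by rewrite mulr_gt0 ?exprn_gt0.
have Y0 : 0 < p ^+ (n.+1 - 2) * (1 - p) ^+ 2 by rewrite mulr_gt0 ?exprn_gt0.
move: (p ^+ (n.+1 - 1) * _) (p ^+ (n.+1 - 2) * _) X0 Y0 => X Y X0 Y0 h1 h2 h3.
rewrite -!addrA ltrD2l; case: h3 => h3.
  by rewrite ltr_leD ?ltr_pM2r ?ler_pM2r ?ltr_nat ?ler_nat.
by rewrite ler_ltD ?ltr_pM2r ?ler_pM2r ?ltr_nat ?ler_nat.
Qed.

(** Two zero lengths would leave a balanced sum of at most 1. *)
Lemma balanced_theta_lengths (l : 'I_3 -> nat) :
  balanced_lengths l -> (2 <= \sum_i l i)%N -> theta_lengths l.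
Proof.
move=> bl; rewrite sum_ord3 -[(_ + _)%R]/(_ + _ + _)%N => l2 i j.
move: (bl 0 1) (bl 1 0) (bl 0 2%:R) (bl 2%:R 0) (bl 1 2%:R) (bl 2%:R 1) => {bl}.
by case: (ord3P i) => ->; case: (ord3P j) => -> //; lia.
Qed.

Lemma balanced_theta_optimal (R : realType) n (l : 'I_3 -> nat) (G : mgraph) :
  (0 < n)%N -> theta_lengths l -> balanced_lengths l -> (\sum_i l i = n.+1)%N ->
  iso G (theta l) -> uniquely_optimal R n n.+1 G.
Proof.
move=> n0 tl bl ln Gl.
have lG := iso_sym Gl.
have Gn : in_class n n.+1 G := iso_in_class lG (theta_in_class tl ln).
split=> // H Hn nHG p p01.
have [c cc ck] := iso_cycle_colouring lG (theta_cycle_colouring tl).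
have {}ck i : colour_size c i = l i by rewrite ck theta_colour_size.
have [nH mH Hc] := Hn.
have mnH : #|edge H| = #|vertex H|.+1 by rewrite nH mH.
have [|d cd] := cycle_colouring_exists _ mnH Hc; first by rewrite nH.
have le_d : (\sum_i colour_size d i <= \sum_i l i)%N.
  by rewrite -card_coloured ln -mH max_card.
have : (\sum_i colour_size d i < \sum_i l i)%N \/
       ~ balanced_lengths (colour_size d).
  move: le_d; rewrite leq_eqVlt => /orP[/eqP d_eq|]; [right=> bd|by left].
  (* Then H has no bridge and has balanced classes, so it is isomorphic to G. *)
  have [f finj lf] := balanced_lengths_perm bl bd (esym d_eq).
  apply: nHG; apply: iso_trans lG; apply: iso_sym.
  apply: (cycle_colouring_iso Hc mnH cd _ finj lf tl) => e.
  have /eqP/setP/(_ e) : [set e | d e != None] == setT.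
    by rewrite eqEcard subsetT /= cardsT card_coloured d_eq ln mH.
  by rewrite !inE.
move=> /(pair_products_balanced bl le_d)[le_pp lt_or].
have E : (\sum_i colour_size c i = \sum_i l i)%N.
  by apply: eq_bigr => i _; rewrite ck.
have Ep : pair_products (colour_size c) = pair_products l.
  by rewrite /pair_products !ck.
apply: (reliability_lt n0 Gn Hn cc cd p01); by rewrite ?Ep ?E.
Qed.

Lemma balanced_lengths_exist m :
  exists2 l : 'I_3 -> nat, balanced_lengths l & (\sum_i l i = m)%N.
Proof.
exists (fun i => (m + i) %/ 3)%N => [i j|].
  by have := ltn_ord i; have := ltn_ord j; lia.
rewrite sum_ord3 -[(_ + _)%R]/(_ + _ + _)%N /=; lia.
Qed.

Theorem proposition4p1 (R : realType) (n : nat) (hn : (1 <= n)%N) :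
  (exists G : mgraph, uniquely_optimal R n n.+1 G) /\
  (forall G : mgraph,
     uniquely_optimal R n n.+1 G <-> balanced_theta G /\ #|edge G| = n.+1).
Proof.
have [l bl ln] := balanced_lengths_exist n.+1.
have tl : theta_lengths l by apply: balanced_theta_lengths; rewrite ?ln.
have iso_refl (G : mgraph) : iso G G.
  exists id, id; split=> [||e]; [exact: inv_bij|exact: inv_bij|].
  by left; case: (ends e).
have opt_l := balanced_theta_optimal R hn tl bl ln (iso_refl _).
split=> [|G]; first by exists (theta l).
split=> [[Gn optG]|[[k [tk bk Gk]] mG]].
  split; last by case: Gn.
  exists l; split=> //; have [ln' optl] := opt_l.
  have [//|nGl] := boolp.pselect (iso G (theta l)).
  (* Two nonisomorphic optimal graphs would each beat the other at p = 1/2. *)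
  have p01 : 0 < (2^-1 : R) < 1 by rewrite invr_gt0 ltr0n invf_lt1 ?ltr0n ?ltr1n.
  have := optl G Gn nGl _ p01; rewrite ltNge le_eqVlt optG ?orbT // => lG.
  exact: nGl (iso_sym lG).
apply: (balanced_theta_optimal R hn tk bk _ Gk).
rewrite -card_theta_edge -mG; case: Gk => f [g [_ gb _]].
exact/esym/bij_eq_card/gb.
Qed.
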